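(* Choose the midpoint rule for both the slow and the fast potential: $$V_d(q_k^s,q_{k+1}^s,q_k^f)=\sum_{m=0}^{p-1}\Delta t\,V(\bar q_k^{s,m},\bar q_k^{f,m}),\qquad W_d(q_k^f)=\sum_{m=0}^{p-1}\Delta t\,W(\bar q_k^{f,m}),$$ where $\bar q_k^{s,m}=\tfrac12(q_k^{s,m}+q_k^{s,m+1})$ and $\bar q_k^{f,m}=\tfrac12(q_k^{f,m}+q_k^{f,m+1})$. Then the momentum form of the discrete multirate Euler-Lagrange equations is equivalent to the following $(p,q)$-scheme (for $k=0,\dots,N-1$ and $m=0,\dots,p-1$): $$q^s_{k+1}=q_k^s+\frac{\Delta T}{2}(M^s)^{-1}\Big(p_k^s+p_{k+1}^s-\Delta t\sum_{m=0}^{p-1}\Big(1-\frac{2m+1}{p}\Big)\frac{\partial V}{\partial q^s}(\bar q_k^{s,m},\bar q_k^{f,m})\Big),$$ $$p^s_{k+1}=p_k^s-\Delta t\sum_{m=0}^{p-1}\frac{\partial V}{\partial q^s}(\bar q_k^{s,m},\bar q_k^{f,m}),$$ $$q_k^{f,m+1}=q_k^{f,m}+\Delta t\,(M^f)^{-1}\frac{p_k^{f,m}+p_k^{f,m+1}}{2},$$ $$p_k^{f,m+1}=p_k^{f,m}-\Delta t\frac{\partial V}{\partial q^f}(\bar q_k^{s,m},\bar q_k^{f,m})-\Delta t\,\nabla W(\bar q_k^{f,m}).$$ Equivalently, it can be written as the transformed $(p,q)$-scheme, with the same two fast equations and with the slow equations replaced by $$\tilde p_k^s=p_k^s-\Delta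 t\sum_{m=0}^{p-1}\Big(1-\frac{2m+1}{p}\Big)\frac{\partial V}{\partial q^s}(\bar q_k^{s,m},\bar q_k^{f,m}),$$ $$q_{k+1}^s=q_k^s+\Delta T\,(M^s)^{-1}\frac{\tilde p_k^s+p_{k+1}^s}{2},$$ $$p_{k+1}^s=\tilde p_k^s-\Delta t\sum_{m=0}^{p-1}\frac{2m+1}{p}\frac{\partial V}{\partial q^s}(\bar q_k^{s,m},\bar q_k^{f,m}).$$
   Context: Let $Q=Q^s\times Q^f\subset\mathbb{R}^{n^s}\times\mathbb{R}^{n^f}$ be open, with slow variables $q^s$ and fast variables $q^f$. The multirate Lagrangian is $L=\tfrac12(\dot q^s)^TM^s\dot q^s+\tfrac12(\dot q^f)^TM^f\dot q^f-V(q^s,q^f)-W(q^f)$, with symmetric invertible mass matrices $M^s,M^f$ (so $L$ is regular), smooth slow potential $V$ and smooth fast potential $W$. Let $\Delta T=p\,\Delta t$, where $p\in\mathbb{N}$ (without indices) is the number of micro steps per macro step; indexed symbols $p_k^s,\ p_k^{f,m}$ denote momenta. Discrete slow configurations $q_k^s$, $k=0,\dots,N$, live on macro nodes $k\Delta T$; discrete fast configurations $q_k^{f,m}$, $k=0,\dots,N-1$, $m=0,\dots,p$, live on micro nodes $k\Delta T+m\Delta t$, with $q_{k-1}^{f,p}=q_k^{f,0}$; $q_k^f=(q_k^{f,0},\dots,q_k^{f,p})$. The slow values at micro nodes are linearly interpolated: $q_k^{s,m}=q_k^s+\tfrac{m}{p}(q_{k+1}^s-q_k^s)$. The discrete Lagrangian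 is $L_d=T_d-V_d-W_d$ with $$T_d=\frac{\Delta T}{2}\Big(\frac{q_{k+1}^s-q_k^s}{\Delta T}\Big)^TM^s\Big(\frac{q_{k+1}^s-q_k^s}{\Delta T}\Big)+\sum_{m=0}^{p-1}\frac{\Delta t}{2}\Big(\frac{q_k^{f,m+1}-q_k^{f,m}}{\Delta t}\Big)^TM^f\Big(\frac{q_k^{f,m+1}-q_k^{f,m}}{\Delta t}\Big).$$ It is written as $L_d(q_k^s,q_{k+1}^s,q_k^f)=\sum_{m=0}^{p-1}L_d^m(q_k^s,q_{k+1}^s,q_k^{f,m},q_k^{f,m+1})$, where $L_d^m$ collects the contributions of the $m$-th micro interval. The discrete multirate Euler-Lagrange equations (stationarity of $\sum_kL_d(q_k^s,q_{k+1}^s,q_k^f)$ with fixed end points) express matching of left and right discrete momenta at all macro and micro nodes. Their momentum form, with unique momenta $p_k^s$ and $p_k^{f,m}$ and $p_{k-1}^{f,p}=p_k^{f,0}$, is: for $k=0,\dots,N-1$ and $m=0,\dots,p-1$, $$p_k^s=-D_{q_k^s}L_d(q_k^s,q_{k+1}^s,q_k^f),\qquad p_{k+1}^s=D_{q_{k+1}^s}L_d(q_k^s,q_{k+1}^s,q_k^f),$$ $$p_k^{f,m}=-D_{q_k^{f,m}}L_d^m(q_k^s,q_{k+1}^s,q_k^{f,m},q_k^{f,m+1}),\qquad p_k^{f,m+1}=D_{q_k^{f,m+1}}L_d^m(q_k^s,q_{k+1}^s,q_k^{f,m},q_k^{f,m+1}),$$ where $D_*$ is the partial derivative with respect to the argument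 $*$ (written as a column vector). *)

(* Defs.v *)
From HB Require Import structures.
From mathcomp Require Import all_boot all_order all_algebra.
From mathcomp Require Import all_classical all_reals all_analysis.

Set Implicit Arguments.
Unset Strict Implicit.
Unset Printing Implicit Defensive.
Import Order.TTheory GRing.Theory Num.Theory.
Import numFieldNormedType.Exports.
Local Open Scope ring_scope.
Local Open Scope classical_set_scope.

(* C^k on U, by recursion through directional derivatives; for U open in a
   finite-dimensional space this is the usual class C^k(U). *)
Fixpoint Ck_on (R : realType) (E : normedModType R) (k : nat) (U : set E)
    (f : E -> R) : Prop :=
  match k with
  | 0 => forall x, U x -> {for x, continuous f}
  | k'.+1 => (forall x, U x -> differentiable f x) /\
             forall v : E, Ck_on k' U (fun x => 'D_v f x)
  end.

Definition smooth_on (R : realType) (E : normedModType R) (U : set E)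
    (f : E -> R) : Prop := forall k : nat, Ck_on k U f.

(* The column vector of the partial derivatives of f at x. *)
Definition grad (R : realType) (n : nat) (f : 'cV[R]_n -> R) (x : 'cV[R]_n) :
  'cV[R]_n := \col_i 'D_(delta_mx i 0) f x.

(* Partial gradients of V with respect to q^s and to q^f, at (x, y). *)
Definition grad_s (R : realType) (ns nf : nat)
    (V : 'cV[R]_ns * 'cV[R]_nf -> R) (x : 'cV[R]_ns) (y : 'cV[R]_nf) :
  'cV[R]_ns := grad (fun x' => V (x', y)) x.

Definition grad_f (R : realType) (ns nf : nat)
    (V : 'cV[R]_ns * 'cV[R]_nf -> R) (x : 'cV[R]_ns) (y : 'cV[R]_nf) :
  'cV[R]_nf := grad (fun y' => V (x, y')) y.

Definition quad (R : realType) (n : nat) (M : 'M[R]_n) (v : 'cV[R]_n) : R :=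
  (v^T *m M *m v) 0 0.

Section Multirate.
Context {R : realType} {ns nf : nat}.
Context (Ms : 'M[R]_ns) (Mf : 'M[R]_nf).
Context (V : 'cV[R]_ns * 'cV[R]_nf -> R) (W : 'cV[R]_nf -> R).
Context (p : nat) (dt : R).

Definition macro_step : R := p%:R * dt.
Local Notation DT := macro_step.

Implicit Types (a b : 'cV[R]_ns) (u w : 'cV[R]_nf) (m : nat).

(* In the next definitions a and b stand for q^s_k and q^s_{k+1}, u and w for
   q^{f,m}_k and q^{f,m+1}_k, and qfk for the family (q^{f,0}_k, ..., q^{f,p}_k),
   of which only the entries 0, ..., p are used. *)
Definition qs_micro a b m : 'cV[R]_ns := a + (m%:R / p%:R) *: (b - a).

Definition qs_mid a b m : 'cV[R]_ns :=
  2^-1 *: (qs_micro a b m + qs_micro a b m.+1).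

Definition qf_mid u w : 'cV[R]_nf := 2^-1 *: (u + w).

Definition Td a b (qfk : nat -> 'cV[R]_nf) : R :=
  DT / 2 * quad Ms (DT^-1 *: (b - a))
  + \sum_(m < p) dt / 2 * quad Mf (dt^-1 *: (qfk m.+1 - qfk m)).

Definition Vd a b (qfk : nat -> 'cV[R]_nf) : R :=
  \sum_(m < p) dt * V (qs_mid a b m, qf_mid (qfk m) (qfk m.+1)).

Definition Wd (qfk : nat -> 'cV[R]_nf) : R :=
  \sum_(m < p) dt * W (qf_mid (qfk m) (qfk m.+1)).

Definition Ld a b (qfk : nat -> 'cV[R]_nf) : R :=
  Td a b qfk - Vd a b qfk - Wd qfk.

(* Contribution of the m-th micro interval; the slow kinetic energy, constant
   over the macro interval, is distributed evenly (DT = p dt). *)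
Definition Ldm m a b u w : R :=
  dt / 2 * quad Ms (DT^-1 *: (b - a))
  + dt / 2 * quad Mf (dt^-1 *: (w - u))
  - dt * V (qs_mid a b m, qf_mid u w)
  - dt * W (qf_mid u w).

Lemma Ld_sum a b (qfk : nat -> 'cV[R]_nf) :
  Ld a b qfk = \sum_(m < p) Ldm m a b (qfk m) (qfk m.+1).
Proof.
rewrite /Ldm !sumrB big_split /= sumr_const card_ord /Ld /Td /Vd /Wd.
by rewrite /macro_step -mulrA -[in LHS]mulrA [in LHS]mulr_natl [in LHS]mulrA.
Qed.

Section Trajectories.
Context (N : nat).

(* The end of a macro interval and the start of the next one are the same
   node: x_{k}^{f,p} = x_{k+1}^{f,0}. *)
Definition micro_matching (x : nat -> nat -> 'cV[R]_nf) : Prop :=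
  forall k, (k.+1 < N)%N -> x k p = x k.+1 0%N.

(* All configurations, and all midpoints at which the potentials are
   evaluated, lie in the configuration space Qs x Qf (which is not assumed to
   be convex). *)
Definition config_in (Qs : set 'cV[R]_ns) (Qf : set 'cV[R]_nf)
    (qs : nat -> 'cV[R]_ns) (qf : nat -> nat -> 'cV[R]_nf) : Prop :=
  [/\ forall k, (k <= N)%N -> Qs (qs k),
      forall k m, (k < N)%N -> (m <= p)%N -> Qf (qf k m) &
      forall k m, (k < N)%N -> (m < p)%N ->
        Qs (qs_mid (qs k) (qs k.+1) m) /\ Qf (qf_mid (qf k m) (qf k m.+1))].

Context (qs : nat -> 'cV[R]_ns) (qf : nat -> nat -> 'cV[R]_nf).
Context (ps : nat -> 'cV[R]_ns) (pf : nat -> nat -> 'cV[R]_nf).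

Local Notation qsbar k m := (qs_mid (qs k) (qs k.+1) m).
Local Notation qfbar k m := (qf_mid (qf k m) (qf k m.+1)).
Local Notation dVs k m := (grad_s V (qsbar k m) (qfbar k m)).
Local Notation dVf k m := (grad_f V (qsbar k m) (qfbar k m)).

Definition momentum_form : Prop :=
  forall k, (k < N)%N ->
  [/\ ps k = - grad (fun a => Ld a (qs k.+1) (qf k)) (qs k),
      ps k.+1 = grad (fun b => Ld (qs k) b (qf k)) (qs k.+1) &
      forall m, (m < p)%N ->
        pf k m =
          - grad (fun u => Ldm m (qs k) (qs k.+1) u (qf k m.+1)) (qf k m) /\
        pf k m.+1 =
          grad (fun w => Ldm m (qs k) (qs k.+1) (qf k m) w) (qf k m.+1)].

Definition fast_scheme (k : nat) : Prop :=
  forall m, (m < p)%N ->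
  qf k m.+1 = qf k m + dt *: (invmx Mf *m (2^-1 *: (pf k m + pf k m.+1))) /\
  pf k m.+1 = pf k m - dt *: dVf k m - dt *: grad W (qfbar k m).

Definition pq_scheme : Prop :=
  forall k, (k < N)%N ->
  [/\ qs k.+1 = qs k + (DT / 2) *: (invmx Ms *m
        (ps k + ps k.+1
         - dt *: \sum_(m < p) (1 - (2 * m + 1)%:R / p%:R) *: dVs k m)),
      ps k.+1 = ps k - dt *: \sum_(m < p) dVs k m &
      fast_scheme k].

Definition transformed_pq_scheme (pst : nat -> 'cV[R]_ns) : Prop :=
  forall k, (k < N)%N ->
  [/\ pst k = ps k
        - dt *: \sum_(m < p) (1 - (2 * m + 1)%:R / p%:R) *: dVs k m,
      qs k.+1 = qs k + DT *: (invmx Ms *m (2^-1 *: (pst k + ps k.+1))),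
      ps k.+1 = pst k
        - dt *: \sum_(m < p) ((2 * m + 1)%:R / p%:R) *: dVs k m &
      fast_scheme k].

End Trajectories.
End Multirate.

(* Main.v *)
(* On each interval the left and right momenta have the form P = M dq / h + A
   and P' = M dq / h - B, where A and B are the shares of the potential force
   attributed to the two end nodes. Since M is invertible, this pair of
   equations is equivalent to their difference P' = P - (A + B) together with
   their half sum solved for dq. Through the interpolation of the slow variable
   the m-th midpoint is (1 - c) q_k + c q_(k+1) with c = (2m+1)/(2p), so the slow
   forces split with weights 1 - c and c; for the fast variable both weights are
   1/2 and A - B drops out. *)
Require Import Defs.
From HB Require Import structures.
From mathcomp Require Import all_boot all_order all_algebra.
From mathcomp Require Import all_classical all_reals all_analysis.
From mathcomp Require Import ring.

Set Implicit Arguments.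
Unset Strict Implicit.
Unset Printing Implicit Defensive.
Import Order.TTheory GRing.Theory Num.Theory.
Import numFieldNormedType.Exports.
Local Open Scope ring_scope.
Local Open Scope classical_set_scope.

(** ['D_v f x] is total and its value says nothing when the limit fails to exist, so existence and
    value of every partial derivative are carried together and the rules below compose. *)
Definition has_grad (R : realType) (n : nat) (f : 'cV[R]_n -> R)
    (x g : 'cV[R]_n) : Prop :=
  forall i, is_derive x (delta_mx i 0) f (g i 0).

(** * Rules for computing gradients *)

Section Gradient.
Context {R : realType} {n : nat}.
Implicit Types (f : 'cV[R]_n -> R) (x g c : 'cV[R]_n).

Lemma has_grad_grad f x g : has_grad f x g -> grad f x = g.
Proof.
move=> fg; apply/matrixP => i j; rewrite !mxE ord1.
by case: (fg i).
Qed.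

Lemma has_gradD f1 f2 x g1 g2 : has_grad f1 x g1 -> has_grad f2 x g2 ->
  has_grad (fun a => f1 a + f2 a) x (g1 + g2).
Proof. by move=> h1 h2 i; rewrite mxE; exact: is_deriveD (h1 i) (h2 i). Qed.

Lemma has_gradB f1 f2 x g1 g2 : has_grad f1 x g1 -> has_grad f2 x g2 ->
  has_grad (fun a => f1 a - f2 a) x (g1 - g2).
Proof. by move=> h1 h2 i; rewrite !mxE; exact: is_deriveB (h1 i) (h2 i). Qed.

Lemma has_gradZ k f x g : has_grad f x g -> has_grad (fun a => k * f a) x (k *: g).
Proof. by move=> h i; rewrite mxE; exact: is_deriveZ (h i). Qed.

Lemma has_grad_cst k x : has_grad (fun=> k) x 0.
Proof. by move=> i; rewrite mxE; exact: is_derive_cst. Qed.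

Lemma has_grad_sum p (f : 'I_p -> 'cV[R]_n -> R) x (g : 'I_p -> 'cV[R]_n) :
  (forall m, has_grad (f m) x (g m)) ->
  has_grad (fun a => \sum_(m < p) f m a) x (\sum_(m < p) g m).
Proof.
move=> h i; rewrite summxE.
have -> : (fun a => \sum_(m < p) f m a) = \sum_(m < p) f m.
  by apply/funext => a; rewrite fct_sumE.
by apply: is_derive_sum => m; exact: h.
Qed.

(** The slow and fast midpoints have this affine form in each single node; the slope [k] becomes the
    weight of the potential force at that node. *)
Lemma has_grad_affine f A x c (k : R) : (forall a, A a = c + k *: a) ->
  differentiable f (A x) ->
  has_grad (fun a => f (A a)) x (k *: grad f (A x)).
Proof.
move=> AE df i.
have dA : is_derive x (delta_mx i 0) A (k *: delta_mx i 0).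
  have -> : A = cst c + k \*: id by apply/funext => a; rewrite AE.
  by apply: is_derive_eq; rewrite add0r.
have diffA : differentiable A x.
  have -> : A = cst c + k *: (id : 'cV[R]_n -> 'cV[R]_n).
    by apply/funext => a; rewrite AE.
  by apply: differentiableD => //; exact: differentiableZ.
apply: DeriveDef; first exact/diff_derivable/differentiable_comp.
(* Chain rule: the differential of [f] at [A x] is applied to the directional derivative
   [k *: delta_mx i 0] of [A], and linearity pulls out [k]. *)
rewrite deriveE; last exact: differentiable_comp.
rewrite diff_comp //= -(deriveE _ diffA) (@derive_val _ _ _ _ _ _ _ dA) linearZ.
by rewrite !mxE deriveE.
Qed.

Lemma quadDZ (M : 'M[R]_n) x (v : 'cV[R]_n) (h : R) : M^T = M ->
  quad M (x + h *: v) = quad M x + h * (2 * (v^T *m (M *m x)) 0 0)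
                        + h ^+ 2 * quad M v.
Proof.
move=> Msym; rewrite /quad.
(* Symmetry of [M] makes the two cross terms transposes of each other, hence equal as 1 by 1
   matrices. *)
have sw : v^T *m M *m x = (x^T *m M *m v)^T.
  by rewrite !trmx_mul trmxK Msym -mulmxA.
have trD : (x + h *: v)^T = x^T + h *: v^T by apply/matrixP => i j; rewrite !mxE.
have -> : (x + h *: v)^T *m M *m (x + h *: v) =
    x^T *m M *m x + h *: (x^T *m M *m v + v^T *m M *m x) +
    h ^+ 2 *: (v^T *m M *m v).
  rewrite trD !(mulmxDl, mulmxDr) -!scalemxAl -!scalemxAr scalerA expr2.
  by rewrite scalerDr !addrA [X in X + _]addrAC.
rewrite mulmxA sw.
move: (x^T *m M *m x) (x^T *m M *m v) (v^T *m M *m v) => P B C.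
by rewrite !mxE; ring.
Qed.

(** By [quadDZ] the difference quotient at nonzero [h] is exactly the claimed value plus a term
    linear in [h]. *)
Lemma has_grad_quad M A x c (k : R) : M^T = M -> (forall a, A a = c + k *: a) ->
  has_grad (fun a => quad M (A a)) x ((2 * k) *: (M *m A x)).
Proof.
move=> Msym AE i; set e := delta_mx i 0 : 'cV[R]_n.
have eE : (e^T *m (M *m A x)) 0 0 = (M *m A x) i 0.
  by rewrite /e trmx_delta -rowE mxE.
have lim0 : h^-1 *: (((fun a => quad M (A a)) \o shift x) (h *: e) - quad M (A x))
    @[h --> 0^'] --> ((2 * k) *: (M *m A x)) i 0.
  apply: (@cvg_trans _ ((((2 * k) * (M *m A x) i 0) + h * (k ^+ 2 * quad M e))
    @[h --> 0^'])).
    apply: near_eq_cvg; near=> h.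
    have h0 : h != 0 by near: h; exact: nbhs_dnbhs_neq.
    have -> : ((fun a => quad M (A a)) \o shift x) (h *: e) =
        quad M (A x + (h * k) *: e).
      by rewrite /= !AE scalerDr scalerA mulrC addrA addrAC.
    rewrite quadDZ // eE /GRing.scale /=.
    by field.
  (* The claimed value is that expression at [h = 0], so the limit can be taken termwise. *)
  have -> : ((2 * k) *: (M *m A x)) i 0 =
      2 * k * (M *m A x) i 0 + 0 * (k ^+ 2 * quad M e).
    by rewrite mxE mul0r addr0.
  apply: cvg_within_filter; apply: cvgD; first exact: cvg_cst.
  by apply: cvgMl; exact: cvg_id.
by apply: DeriveDef; [apply/cvg_ex; eexists; exact: lim0 | exact: cvg_lim lim0].
Unshelve. all: by end_near. Qed.

End Gradient.

(** * Left and right discrete momenta of the midpoint Lagrangian *)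

Section Momenta.
Context {R : realType} {ns nf : nat}.
Context (Ms : 'M[R]_ns) (Mf : 'M[R]_nf).
Context (V : 'cV[R]_ns * 'cV[R]_nf -> R) (W : 'cV[R]_nf -> R).
Context (p : nat) (dt : R).
Hypotheses (Ms_sym : Ms^T = Ms) (Mf_sym : Mf^T = Mf).
Hypotheses (p_gt0 : (0 < p)%N) (dt_gt0 : 0 < dt).

Local Notation DT := (macro_step p dt).

Implicit Types (a b x : 'cV[R]_ns) (u w y : 'cV[R]_nf).

Local Lemma p_neq0 : p%:R != 0 :> R.
Proof. by rewrite pnatr_eq0 -lt0n. Qed.

Local Lemma dt_neq0 : dt != 0.
Proof. exact: lt0r_neq0. Qed.

Local Lemma macro_step_neq0 : DT != 0.
Proof. by rewrite mulf_neq0 ?p_neq0 ?dt_neq0. Qed.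

(** The weight of [b] is the mean of the interpolation parameters [m / p] and [(m + 1) / p]. *)
Lemma qs_midE a b m : qs_mid p a b m =
  (1 - (2 * m + 1)%:R / (2 * p%:R)) *: a + ((2 * m + 1)%:R / (2 * p%:R)) *: b.
Proof.
apply/matrixP => i j; rewrite !mxE natrD natrM -(natr1 m).
by field; exact: p_neq0.
Qed.

Lemma differentiable_slow x y : differentiable V (x, y) ->
  differentiable (fun x' => V (x', y)) x.
Proof.
by move=> dV; apply: (differentiable_comp (f := fun x' => (x', y))) => //.
Qed.

Lemma differentiable_fast x y : differentiable V (x, y) ->
  differentiable (fun y' => V (x, y')) y.
Proof.
by move=> dV; apply: (differentiable_comp (f := fun y' => (x, y'))) => //.
Qed.

(** In the left node the slow velocity has slope [- DT^-1] and the m-th midpoint has slope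
    [1 - (2m + 1) / (2p)]. *)
Lemma grad_Ld_left a b (qfk : nat -> 'cV[R]_nf) :
  (forall m, (m < p)%N ->
     differentiable V (qs_mid p a b m, qf_mid (qfk m) (qfk m.+1))) ->
  - grad (fun a => Ld Ms Mf V W p dt a b qfk) a =
    DT^-1 *: (Ms *m (b - a)) + dt *: \sum_(m < p)
      (1 - (2 * m + 1)%:R / (2 * p%:R)) *:
        grad_s V (qs_mid p a b m) (qf_mid (qfk m) (qfk m.+1)).
Proof.
move=> dV; apply: oppr_inj; rewrite opprK.
have AE a' : DT^-1 *: (b - a') = DT^-1 *: b + (- DT^-1) *: a'.
  by rewrite scalerBr scaleNr.
have kin := has_gradZ (DT / 2) (has_grad_quad a Ms_sym AE).
have pot (m : 'I_p) : has_grad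
    (fun a' => V (qs_mid p a' b m, qf_mid (qfk m) (qfk m.+1))) a
    ((1 - (2 * m + 1)%:R / (2 * p%:R)) *:
        grad_s V (qs_mid p a b m) (qf_mid (qfk m) (qfk m.+1))).
  apply: (has_grad_affine (f := fun x' => V (x', _)) (A := fun a' => qs_mid p a' b m)
    (c := ((2 * m + 1)%:R / (2 * p%:R)) *: b)).
    by move=> a'; rewrite qs_midE addrC.
  exact/differentiable_slow/dV.
(* The nesting mirrors [Td - Vd - Wd]; the constants are the fast kinetic sum and [Wd]. *)
rewrite [LHS](has_grad_grad (has_gradB (has_gradB (has_gradD kin (has_grad_cst _ a))
  (has_grad_sum (fun m => has_gradZ dt (pot m)))) (has_grad_cst (Wd W p dt qfk) a))).
rewrite addr0 subr0 -scaler_sumr opprD; congr (_ - _).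
rewrite -scalemxAr !scalerA -scaleNr; congr (_ *: _).
by field; exact: macro_step_neq0.
Qed.

(** In the right node the velocity has slope [DT^-1] and the midpoints have the complementary
    weights. *)
Lemma grad_Ld_right a b (qfk : nat -> 'cV[R]_nf) :
  (forall m, (m < p)%N ->
     differentiable V (qs_mid p a b m, qf_mid (qfk m) (qfk m.+1))) ->
  grad (fun b => Ld Ms Mf V W p dt a b qfk) b =
    DT^-1 *: (Ms *m (b - a)) - dt *: \sum_(m < p)
      ((2 * m + 1)%:R / (2 * p%:R)) *:
        grad_s V (qs_mid p a b m) (qf_mid (qfk m) (qfk m.+1)).
Proof.
move=> dV.
have AE b' : DT^-1 *: (b' - a) = - (DT^-1 *: a) + DT^-1 *: b'.
  by rewrite scalerBr addrC.
have kin := has_gradZ (DT / 2) (has_grad_quad b Ms_sym AE).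
have pot (m : 'I_p) : has_grad
    (fun b' => V (qs_mid p a b' m, qf_mid (qfk m) (qfk m.+1))) b
    (((2 * m + 1)%:R / (2 * p%:R)) *:
        grad_s V (qs_mid p a b m) (qf_mid (qfk m) (qfk m.+1))).
  apply: (has_grad_affine (f := fun x' => V (x', _)) (A := fun b' => qs_mid p a b' m)
    (c := (1 - (2 * m + 1)%:R / (2 * p%:R)) *: a)).
    by move=> b'; rewrite qs_midE.
  exact/differentiable_slow/dV.
rewrite [LHS](has_grad_grad (has_gradB (has_gradB (has_gradD kin (has_grad_cst _ b))
  (has_grad_sum (fun m => has_gradZ dt (pot m)))) (has_grad_cst (Wd W p dt qfk) b))).
rewrite addr0 subr0 -scaler_sumr; congr (_ - _).
rewrite -scalemxAr !scalerA; congr (_ *: _).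
by field; exact: macro_step_neq0.
Qed.

(** The fast midpoint has slope 1/2 in either node, so each end receives half of the force of the
    micro interval. *)
Lemma grad_Ldm_left m a b u w :
  differentiable V (qs_mid p a b m, qf_mid u w) ->
  differentiable W (qf_mid u w) ->
  - grad (fun u => Ldm Ms Mf V W p dt m a b u w) u =
    dt^-1 *: (Mf *m (w - u)) + (dt / 2) *:
      (grad_f V (qs_mid p a b m) (qf_mid u w) + grad W (qf_mid u w)).
Proof.
move=> dV dW; apply: oppr_inj; rewrite opprK.
have AE u' : dt^-1 *: (w - u') = dt^-1 *: w + (- dt^-1) *: u'.
  by rewrite scalerBr scaleNr.
have mid u' : qf_mid u' w = 2^-1 *: w + 2^-1 *: u'.
  by rewrite /qf_mid scalerDr addrC.
have kin := has_gradZ (dt / 2) (has_grad_quad u Mf_sym AE).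
have potV := has_gradZ dt (has_grad_affine mid (differentiable_fast dV)).
have potW := has_gradZ dt (has_grad_affine mid dW).
rewrite [LHS](has_grad_grad (has_gradB (has_gradB (has_gradD (has_grad_cst
  (dt / 2 * quad Ms (DT^-1 *: (b - a))) u) kin) potV) potW)).
rewrite add0r -addrA -opprD !scalerA -scalerDr opprD; congr (_ - _ *: _).
rewrite -scalemxAr !scalerA -scaleNr; congr (_ *: _).
by field; exact: dt_neq0.
Qed.

Lemma grad_Ldm_right m a b u w :
  differentiable V (qs_mid p a b m, qf_mid u w) ->
  differentiable W (qf_mid u w) ->
  grad (fun w => Ldm Ms Mf V W p dt m a b u w) w =
    dt^-1 *: (Mf *m (w - u)) - (dt / 2) *:
      (grad_f V (qs_mid p a b m) (qf_mid u w) + grad W (qf_mid u w)).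
Proof.
move=> dV dW.
have AE w' : dt^-1 *: (w' - u) = - (dt^-1 *: u) + dt^-1 *: w'.
  by rewrite scalerBr addrC.
have mid w' : qf_mid u w' = 2^-1 *: u + 2^-1 *: w'.
  by rewrite /qf_mid scalerDr.
have kin := has_gradZ (dt / 2) (has_grad_quad w Mf_sym AE).
have potV := has_gradZ dt (has_grad_affine mid (differentiable_fast dV)).
have potW := has_gradZ dt (has_grad_affine mid dW).
rewrite [LHS](has_grad_grad (has_gradB (has_gradB (has_gradD (has_grad_cst
  (dt / 2 * quad Ms (DT^-1 *: (b - a))) w) kin) potV) potW)).
rewrite add0r -addrA -opprD !scalerA -scalerDr; congr (_ - _ *: _).
rewrite -scalemxAr !scalerA; congr (_ *: _).
by field; exact: dt_neq0.
Qed.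

End Momenta.

(* Half the sum and the difference of the two momentum equations. *)
Lemma momenta_scheme (R : realType) (n : nat) (M : 'M[R]_n) (h : R)
    (a b P P' A B : 'cV[R]_n) : M \in unitmx -> h != 0 ->
  (P = h^-1 *: (M *m (b - a)) + A /\ P' = h^-1 *: (M *m (b - a)) - B) <->
  (b = a + (h / 2) *: (invmx M *m (P + P' - (A - B))) /\ P' = P - (A + B)).
Proof.
move=> Mu h0; split=> [[-> ->]|[bE PE]].
  set X := h^-1 *: _.
  (* Subtracting [A - B] cancels the forces from the sum of the momenta. *)
  have -> : X + A + (X - B) - (A - B) = (2 * h^-1) *: (M *m (b - a)).
    by rewrite -scalerA -/X; apply/matrixP => i j; rewrite !mxE; ring.
  rewrite -scalemxAr mulKmx // scalerA.
  have -> : h / 2 * (2 / h) = 1 by field.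
  by split; apply/matrixP => i j; rewrite !mxE; ring.
(* Inserting [P' = P - (A + B)] turns [P + P' - (A - B)] into [2 (P - A)]. *)
have -> : h^-1 *: (M *m (b - a)) = P - A.
  rewrite bE PE addrAC subrr add0r -scalemxAr mulKVmx // scalerA.
  by apply/matrixP => i j; rewrite !mxE; field.
by rewrite subrK -addrA -opprD.
Qed.

Theorem theorem3p3 (R : realType) (ns nf : nat)
    (Qs : set 'cV[R]_ns) (Qf : set 'cV[R]_nf)
    (Qs_open : open Qs) (Qf_open : open Qf)
    (Ms : 'M[R]_ns) (Mf : 'M[R]_nf)
    (Ms_sym : Ms^T = Ms) (Ms_unit : Ms \in unitmx)
    (Mf_sym : Mf^T = Mf) (Mf_unit : Mf \in unitmx)
    (V : 'cV[R]_ns * 'cV[R]_nf -> R) (W : 'cV[R]_nf -> R)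
    (V_smooth : smooth_on (Qs `*` Qf) V) (W_smooth : smooth_on Qf W)
    (N p : nat) (p_gt0 : (0 < p)%N) (dt : R) (dt_gt0 : 0 < dt)
    (qs : nat -> 'cV[R]_ns) (qf : nat -> nat -> 'cV[R]_nf)
    (ps : nat -> 'cV[R]_ns) (pf : nat -> nat -> 'cV[R]_nf)
    (q_in : config_in p N Qs Qf qs qf)
    (qf_match : micro_matching p N qf) (pf_match : micro_matching p N pf) :
  (momentum_form Ms Mf V W p dt N qs qf ps pf <->
     pq_scheme Ms Mf V W p dt N qs qf ps pf) /\
  (pq_scheme Ms Mf V W p dt N qs qf ps pf <->
     exists pst : nat -> 'cV[R]_ns,
       transformed_pq_scheme Ms Mf V W p dt N qs qf ps pf pst).
Proof.
have p0 : p%:R != 0 :> R by rewrite pnatr_eq0 -lt0n.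
have dt0 : dt != 0 by exact: lt0r_neq0.
have DT0 : macro_step p dt != 0 by rewrite mulf_neq0.
have [_ _ mid_in] := q_in.
(* Class C^1 gives differentiability at all midpoints, which [q_in] keeps inside the configuration
   space. *)
have [dV _] := V_smooth 1%N; have [dW _] := W_smooth 1%N.
have dVk k m : (k < N)%N -> (m < p)%N -> differentiable V
    (qs_mid p (qs k) (qs k.+1) m, qf_mid (qf k m) (qf k m.+1)).
  by move=> kN mp; apply: dV; exact: mid_in.
have dWk k m : (k < N)%N -> (m < p)%N ->
    differentiable W (qf_mid (qf k m) (qf k m.+1)).
  by move=> kN mp; apply: dW; have [] := mid_in k m kN mp.
pose g k m := grad_s V (qs_mid p (qs k) (qs k.+1) m) (qf_mid (qf k m) (qf k m.+1)).
have slow k : (k < N)%N ->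
    (ps k = - grad (fun a => Ld Ms Mf V W p dt a (qs k.+1) (qf k)) (qs k) /\
     ps k.+1 = grad (fun b => Ld Ms Mf V W p dt (qs k) b (qf k)) (qs k.+1)) <->
    (qs k.+1 = qs k + (macro_step p dt / 2) *: (invmx Ms *m
        (ps k + ps k.+1
         - dt *: \sum_(m < p) (1 - (2 * m + 1)%:R / p%:R) *: g k m)) /\
     ps k.+1 = ps k - dt *: \sum_(m < p) g k m).
  move=> kN; rewrite grad_Ld_left ?grad_Ld_right //; try by move=> m; exact: dVk.
  (* With [c = (2m + 1) / (2p)], the weights [1 - c] and [c] of [A] and [B] have sum 1 and
     difference [1 - (2m + 1) / p], the two weights of the scheme. *)
  set A := dt *: \sum_(m < p) _; set B := dt *: \sum_(m < p) _.
  have -> : \sum_(m < p) g k m =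
      \sum_(m < p) (1 - (2 * m + 1)%:R / (2 * p%:R)) *: g k m +
      \sum_(m < p) ((2 * m + 1)%:R / (2 * p%:R)) *: g k m.
    by rewrite -big_split /=; apply: eq_bigr => m _; rewrite -scalerDl subrK scale1r.
  have -> : \sum_(m < p) (1 - (2 * m + 1)%:R / p%:R) *: g k m =
      \sum_(m < p) (1 - (2 * m + 1)%:R / (2 * p%:R)) *: g k m -
      \sum_(m < p) ((2 * m + 1)%:R / (2 * p%:R)) *: g k m.
    rewrite -sumrB; apply: eq_bigr => m _; rewrite -scalerBl; congr (_ *: _).
    by field.
  by rewrite scalerBr scalerDr; exact: momenta_scheme.
have fast k m : (k < N)%N -> (m < p)%N ->
    (pf k m = - grad (fun u => Ldm Ms Mf V W p dt m (qs k) (qs k.+1) u (qf k m.+1))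
                     (qf k m) /\
     pf k m.+1 = grad (fun w => Ldm Ms Mf V W p dt m (qs k) (qs k.+1) (qf k m) w)
                     (qf k m.+1)) <->
    (qf k m.+1 = qf k m + dt *: (invmx Mf *m (2^-1 *: (pf k m + pf k m.+1))) /\
     pf k m.+1 = pf k m
       - dt *: grad_f V (qs_mid p (qs k) (qs k.+1) m) (qf_mid (qf k m) (qf k m.+1))
       - dt *: grad W (qf_mid (qf k m) (qf k m.+1))).
  move=> kN mp; have dVm := dVk k m kN mp; have dWm := dWk k m kN mp.
  (* Here [A = B]: the correction vanishes and the two shares [dt / 2] add up to [dt]. *)
  rewrite grad_Ldm_left // grad_Ldm_right // momenta_scheme //.
  by rewrite subrr subr0 -scalerDl -splitr scalerDr opprD addrA -scalemxAr scalerA.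
split; split.
- move=> H k kN; have [h1 h2 h3] := H k kN.
  have [e1 e2] := (slow k kN).1 (conj h1 h2).
  by split=> // m mp; apply/fast => //; exact: h3.
- move=> H k kN; have [h1 h2 h3] := H k kN.
  have [e1 e2] := (slow k kN).2 (conj h1 h2).
  by split=> // m mp; apply/fast => //; exact: h3.
(* The first transformed equation dictates the witness. *)
- move=> H; exists (fun k => ps k
        - dt *: \sum_(m < p) (1 - (2 * m + 1)%:R / p%:R) *: g k m) => k kN.
  have [h1 h2 h3] := H k kN; split => //.
    by rewrite [LHS]h1 -scalemxAr scalerA addrAC.
  (* The weights of the two partial kicks add up to 1, giving the full momentum update. *)
  rewrite [LHS]h2 -addrA -opprD -scalerDr -big_split /=; congr (_ - _ *: _).
  by apply: eq_bigr => m _; rewrite -scalerDl subrK scale1r.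
- move=> [pst H] k kN; have [h0 h1 h2 h3] := H k kN; split => //.
    by rewrite [LHS]h1 h0 -scalemxAr scalerA addrAC.
  rewrite [LHS]h2 h0 -addrA -opprD -scalerDr -big_split /=; congr (_ - _ *: _).
  by apply: eq_bigr => m _; rewrite -scalerDl subrK scale1r.
Qed.
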